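(* Let $S$ be a semigroup and $T$ a subsemigroup of $S$ of finite Green index. Suppose that $T$ is Markov and that the Schützenberger group of every $T$-relative $\mathcal{H}$-class in $S - T$ is Markov. Then $S$ is Markov.
   Context: A finite alphabet $A$ represents a generating set for a semigroup $S$ if there is a map $\phi : A \to S$ extending to a surjective homomorphism $A^+ \to S$; $\overline{w} = w\phi$ is the element represented by $w \in A^+$. A language $L$ over $A$ is $+$-prefix-closed if for all $u \in A^+$, $v \in A^+$, $uv \in L$ implies $u \in L$. A Markov language for $S$ over $A$ is a regular $+$-prefix-closed language $L \subseteq A^+$ (not containing the empty word) such that every element of $S$ is represented by exactly one word in $L$. A semigroup (in particular a group, regarded as a semigroup) is Markov if it admits a Markov language over some finite alphabet representing a generating set for it. Let $T$ be a subsemigroup of $S$, and let $T^1$ be $T$ with an identity adjoined, where the identity acts trivially on $S$ (so $1x = x1 = x$). The $T$-relative Green's relations on $S$ are: $x\,\mathcal{R}^T\,y \iff xT^1 = yT^1$; $x\,\mathcal{L}^T\,y \iff T^1x = T^1y$; $x\,\mathcal{H}^T\,y \iff x\,\mathcal{R}^T\,y$ and $x\,\mathcal{L}^T\,y$. These are equivalence relations, and each class lies wholly in $T$ or wholly in $S - T$. The $T$-relative $\mathcal{H}$-classes are the $\mathcal{H}^T$-classes. The Green index of $T$ in $S$ is one more than the number of $\mathcal{H}^T$-classes in $S - T$. For an $\mathcal{H}^T$-class $H$, let $\mathrm{Stab}(H) = \{t \in T^1 : Ht = H\}$ and define $\sigma(H)$ on $\mathrm{Stab}(H)$ by $(x,y)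 \in \sigma(H)$ iff $hx = hy$ for all $h \in H$. Then $\sigma(H)$ is a congruence and $\Gamma(H) = \mathrm{Stab}(H)/\sigma(H)$ is a group, the Schützenberger group of $H$. *)

(* Defs.v *)
From HB Require Import structures.
From mathcomp Require Import all_boot.
From mathcomp Require Import boolp classical_sets functions cardinality.

Set Implicit Arguments.
Unset Strict Implicit.
Unset Printing Implicit Defensive.

Local Open Scope classical_set_scope.
Local Open Scope quotient_scope.
Local Open Scope group_scope.

(* Languages over [A] are sets of words [w : seq A]; since the library has no
   automata theory, regularity means recognition by a complete deterministic
   finite automaton. *)
Record dfa (A : finType) := Dfa {
  dfa_state : finType;
  dfa_start : dfa_state;
  dfa_final : {set dfa_state};
  dfa_step : dfa_state -> A -> dfa_state }.

Definition dfa_lang (A : finType) (M : dfa A) : set (seq A) :=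
  [set w | foldl (@dfa_step A M) (dfa_start M) w \in dfa_final M].

Definition regular (A : finType) (L : set (seq A)) : Prop :=
  exists M : dfa A, L = dfa_lang M.

Definition plus_prefix_closed (A : finType) (L : set (seq A)) : Prop :=
  forall u v : seq A, u != [::] -> v != [::] -> L (u ++ v) -> L u.

Section Words.
Variables (A : finType) (S : semigroupType) (phi : A -> S).

(* [word_value a w] is the image of the nonempty word [a :: w] under the
   homomorphism A^+ -> S extending [phi]. *)
Fixpoint word_value (a : A) (w : seq A) : S :=
  if w is b :: w' then phi a * word_value b w' else phi a.

Definition represents (w : seq A) (s : S) : Prop :=
  if w is a :: w' then word_value a w' = s else False.

Lemma represents_cat u v s t :
  represents u s -> represents v t -> represents (u ++ v) (s * t).
Proof.
case: u v => // a u [|b v] //=; elim: u a s => [|c u IHu] a s /= <-.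
  by move=> <-.
by move=> vt; rewrite (IHu c _ erefl vt) mulgA.
Qed.

Definition generating : Prop := forall s : S, exists w, represents w s.

Record markov_language (L : set (seq A)) : Prop := MarkovLanguage {
  markov_regular : regular L;
  markov_nonempty_words : ~ L [::];
  markov_prefix_closed : plus_prefix_closed L;
  markov_unique : forall s : S, exists! w, L w /\ represents w s }.

End Words.

Definition markov (S : semigroupType) : Prop :=
  exists (A : finType) (phi : A -> S),
    generating phi /\ exists L : set (seq A), markov_language phi L.

(* S^1: an identity [None] is adjoined even when [S] already has one. *)
Section AdjoinOne.
Variable S : semigroupType.

Definition adjoin1 : Type := option S.

HB.instance Definition _ := Choice.on adjoin1.

Definition adjoin1_mul (x y : adjoin1) : adjoin1 :=
  match x, y with
  | Some s, Some t => Some (s * t)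
  | None, _ => y
  | _, None => x
  end.

Lemma adjoin1_mulA : associative adjoin1_mul.
Proof. by case=> [x|] [y|] [z|] //=; rewrite mulgA. Qed.

HB.instance Definition _ := isSemigroup.Build adjoin1 adjoin1_mulA.

Lemma adjoin1_mul1 : left_id (None : adjoin1) *%g.
Proof. by case. Qed.

Lemma adjoin1_1mul : right_id (None : adjoin1) *%g.
Proof. by case. Qed.

HB.instance Definition _ :=
  Semigroup_isMonoid.Build adjoin1 adjoin1_mul1 adjoin1_1mul.

End AdjoinOne.

(* Subsemigroups of [S] are the library's [mulgClosed S]; that they are boolean
   predicates is no restriction, classical logic being assumed throughout. *)
Section Relative.
Variables (S : semigroupType) (T : mulgClosed S).

Definition sub_semigroup : Type := {x : S | x \in T}.

HB.instance Definition _ := SubChoice.on sub_semigroup.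

Lemma sub_semigroup_closed : mulg_closed [pred x : S | x \in T].
Proof. exact: gpredM. Qed.

HB.instance Definition _ :=
  SubChoice_isSubSemigroup.Build S [pred x : S | x \in T] sub_semigroup
    sub_semigroup_closed.

Local Notation T1 := (adjoin1 sub_semigroup).

Definition ract (x : S) (t : T1) : S := if t is Some t' then x * val t' else x.
Definition lact (t : T1) (x : S) : S := if t is Some t' then val t' * x else x.

Lemma ractM x (t u : T1) : ract x (t * u) = ract (ract x t) u.
Proof.
by case: t u => [t|] [u|] //; rewrite -[LHS]/(x * val (t * u)) valM mulgA.
Qed.

Lemma lact_ract (t : T1) x (u : T1) : ract (lact t x) u = lact t (ract x u).
Proof. by case: t u => [t|] [u|] //=; rewrite mulgA. Qed.

Definition relR (x y : S) : Prop := range (ract x) = range (ract y).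
Definition relL (x y : S) : Prop := range (lact^~ x) = range (lact^~ y).
Definition relH (x y : S) : Prop := relR x y /\ relL x y.

Definition rel_Hclass (H : set S) : Prop := exists x : S, H = [set y | relH x y].

Definition outer_Hclasses : set (set S) :=
  [set H | rel_Hclass H /\ H `<=` [set x | x \notin T]].

(* The Green index is one more than the number of these classes. *)
Definition finite_green_index : Prop := finite_set outer_Hclasses.

Section Schutzenberger.
Variable H : set S.

Definition in_stab (t : T1) : bool := `[< ract^~ t @` H = H >].
Definition stab : Type := {t : T1 | in_stab t}.

HB.instance Definition _ := SubChoice.on stab.

Lemma stab_image (t : T1) : in_stab t -> forall h, H h -> H (ract h t).
Proof. by move=> /asboolP tH h Hh; rewrite -tH; exists h. Qed.

Lemma in_stabP (t : T1) :
  in_stab t <->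
  (forall h, H h -> H (ract h t)) /\ (forall h, H h -> exists2 g, H g & ract g t = h).
Proof.
split=> [tH|[tH Ht]]; first split; first exact: stab_image.
  by move=> h; rewrite -{1}(asboolW tH) => -[g Hg <-]; exists g.
by apply/asboolP/seteqP; split=> [_ [h Hh <-]|h /Ht[g Hg <-]]; [exact: tH|exists g].
Qed.

Lemma stab_closed : monoid_closed in_stab.
Proof.
split=> [|t u]; first by apply/in_stabP; split=> h Hh //; exists h.
rewrite !unfold_in => /in_stabP[tH Ht] /in_stabP[uH Hu]; apply/in_stabP.
split=> h Hh; first by rewrite ractM; apply/uH/tH.
have [g Hg <-] := Hu _ Hh; have [f Hf <-] := Ht _ Hg.
by exists f => //; rewrite ractM.
Qed.

HB.instance Definition _ :=
  SubChoice_isSubMonoid.Build T1 in_stab stab stab_closed.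

Definition sigma (x y : stab) : bool :=
  `[< forall h, H h -> ract h (val x) = ract h (val y) >].

Lemma sigma_refl : reflexive sigma.
Proof. by move=> x; apply/asboolP. Qed.

Lemma sigma_sym : symmetric sigma.
Proof. by move=> x y; apply/asboolP/asboolP => xy h Hh; rewrite xy. Qed.

Lemma sigma_trans : transitive sigma.
Proof.
move=> y x z /asboolP xy /asboolP yz; apply/asboolP => h Hh.
by rewrite xy // yz.
Qed.

Canonical sigma_equiv := EquivRel sigma sigma_refl sigma_sym sigma_trans.

Lemma sigmaM x x' y y' : sigma x x' -> sigma y y' -> sigma (x * y) (x' * y').
Proof.
move=> /asboolP xx' /asboolP yy'; apply/asboolP => h Hh.
by rewrite !valM !ractM xx' // yy' //; apply: stab_image => //; exact: (valP x').
Qed.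

Definition schutzenberger : Type := {eq_quot sigma}.

HB.instance Definition _ := Choice.on schutzenberger.
HB.instance Definition _ := EqQuotient.on schutzenberger.

Definition schutzenberger_mul : schutzenberger -> schutzenberger -> schutzenberger :=
  lift_op2 schutzenberger *%g.

Lemma pi_schutzenberger_mul :
  {morph \pi_schutzenberger : x y / x * y >-> schutzenberger_mul x y}.
Proof.
move=> x y; unlock schutzenberger_mul; apply/eqmodP/sigmaM.
  by rewrite -eqmodE reprK.
by rewrite -eqmodE reprK.
Qed.

Canonical pi_schutzenberger_mul_morph := PiMorph2 pi_schutzenberger_mul.

Lemma schutzenberger_mulA : associative schutzenberger_mul.
Proof.
elim/quotW=> x; elim/quotW=> y; elim/quotW=> z.
by rewrite -!pi_schutzenberger_mul mulgA.
Qed.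

HB.instance Definition _ := isSemigroup.Build schutzenberger schutzenberger_mulA.

Lemma schutzenberger_mul1g : left_id (\pi_schutzenberger 1) *%g.
Proof.
by elim/quotW=> x; rewrite -[LHS]pi_schutzenberger_mul mul1g.
Qed.

Lemma schutzenberger_mulg1 : right_id (\pi_schutzenberger 1) *%g.
Proof.
by elim/quotW=> x; rewrite -[LHS]pi_schutzenberger_mul mulg1.
Qed.

HB.instance Definition _ :=
  Semigroup_isMonoid.Build schutzenberger schutzenberger_mul1g schutzenberger_mulg1.

(* For an H^T-class the quotient is a group. *)
Lemma schutzenberger_inv : rel_Hclass H ->
  forall x : schutzenberger, exists y, y * x = 1 /\ x * y = 1.
Proof.
move=> [h0 HE]; elim/quotW=> x.
have [xH Hx] := (in_stabP (val x)).1 (valP x).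
have relHH g h : H g -> H h -> relH g h.
  by rewrite HE => -[Rg Lg] [Rh Lh]; split; rewrite /relR /relL -?Rg -?Lg.
have Hh0 : H h0 by rewrite HE.
have [u uh0] : exists u : T1, ract (ract h0 (val x)) u = h0.
  have [R _] := relHH _ _ (xH _ Hh0) Hh0.
  have : range (ract h0) h0 by exists (None : T1).
  by rewrite -R => -[u _ ?]; exists u.
have xu h : H h -> ract (ract h (val x)) u = h.
  move=> Hh; have [_ L] := relHH _ _ Hh0 Hh.
  have : range (lact^~ h) h by exists (None : T1).
  by rewrite -L => -[s _ <-]; rewrite !lact_ract uh0.
have uP : in_stab u.
  apply/in_stabP; split=> h Hh; first by have [g Hg <-] := Hx _ Hh; rewrite xu.
  by exists (ract h (val x)); [exact: xH|exact: xu].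
exists (\pi_schutzenberger (Sub u uP : stab)); split.
  rewrite -[LHS]pi_schutzenberger_mul; apply/eqmodP/asboolP => h Hh.
  have [g Hg <-] := Hx _ Hh.
  by rewrite valM SubK ractM xu.
rewrite -[LHS]pi_schutzenberger_mul; apply/eqmodP/asboolP => h Hh.
by rewrite valM SubK ractM xu.
Qed.

End Schutzenberger.
End Relative.

(* Main.v *)
Require Import Defs.
From mathcomp Require Import all_boot.
From mathcomp Require Import boolp classical_sets functions cardinality.

(* An element of T keeps its word in the Markov language of T. If H is a class
   outside T and h is a point of H, then g |-> h g is a bijection from the
   Schützenberger group of H onto H; a word a b ... c of the Markov language of
   that group is turned into (h a) b ... c, where (h a) is a single new letter
   standing for the element h a of H and b, ..., c stand for representatives in
   T. Fusing h with the first letter keeps the language prefix-closed even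
   though the empty word does not represent the identity of the group. The
   union of these finitely many languages is a Markov language for S. *)

Set Implicit Arguments.
Unset Strict Implicit.
Unset Printing Implicit Defensive.

Local Open Scope classical_set_scope.
Local Open Scope quotient_scope.
Local Open Scope group_scope.

(** * Closure properties of regular languages *)

Section Transducer.
Variables (A B P : finType) (e : P -> B -> option (P * A)).

(** A partial letter-to-letter transducer in which every state accepts. It serves as a decoder: the
    image of a language under an injective encoding is its preimage under decoding. *)
Fixpoint transduce (p : P) (w : seq B) : option (seq A) :=
  if w is b :: w' then
    if e p b is Some (p', a) then omap (cons a) (transduce p' w') else None
  else Some [::].

(** The product automaton runs an automaton for [L] on the output as it is produced; [None] is a
    rejecting sink, entered when the transducer blocks. *)
Lemma regular_transduce p L :
  regular L -> regular [set w | exists2 v, transduce p w = Some v & L v].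
Proof.
move=> [M ->].
pose step (s : option (P * dfa_state M)) b :=
  if s is Some (p, q) then
    if e p b is Some (p', a) then Some (p', dfa_step q a) else None
  else None.
pose final := [set s : option (P * dfa_state M) |
  if s is Some (_, q) then q \in dfa_final M else false]%SET.
exists (@Dfa B _ (Some (p, dfa_start M)) final step).
have stepN w : foldl step None w = None by elim: w.
have stepE w q : foldl step (Some (p, q)) w \in final <->
    exists2 v, transduce p w = Some v & foldl (@dfa_step _ M) q v \in dfa_final M.
  elim: w p q => [|b w IHw] r q /=; first by rewrite inE; split; [exists [::]|case=> _ [<-]].
  case: (e r b) => [[r' a]|]; last by rewrite stepN inE; split=> // -[].
  rewrite IHw; split=> [[v -> vF]|[v]]; first by exists (a :: v).
  by case: transduce => //= u [<-] uF; exists u.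
by apply/seteqP; split=> w /stepE.
Qed.

End Transducer.

Lemma regular_map (A B : finType) (f : A -> B) (L : set (seq A)) :
  injective f -> regular L -> regular [set map f w | w in L].
Proof.
move=> f_inj.
(* The one-state decoder of [f], blocking on letters outside its image. *)
pose e (_ : unit) b := omap (pair tt) [pick a | f a == b].
have eP w v : transduce e tt w = Some v <-> map f v = w.
  elim: w v => [|b w IHw] [|a v] //=; rewrite /e.
    by case: pickP => //= ? _; case: transduce.
  case: pickP => [a' /eqP <-|no_a] /=; last by split=> // -[/eqP]; rewrite no_a.
  split=> [|[/f_inj-> /IHw->//]].
  by case E: transduce => [u|] //= -[<- <-]; congr (_ :: _); apply/IHw.
move=> /(regular_transduce e tt) regL; congr regular: regL.
by apply/seteqP; split=> [w [v /eP ? ?]|w [v ? /eP ?]]; exists v.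
Qed.

Lemma regularU (A : finType) (L M : set (seq A)) :
  regular L -> regular M -> regular (L `|` M).
Proof.
move=> [D ->] [E ->].
pose step (s : dfa_state D * dfa_state E) a := (dfa_step s.1 a, dfa_step s.2 a).
pose final :=
  [set s : dfa_state D * dfa_state E |
    (s.1 \in dfa_final D) || (s.2 \in dfa_final E)]%SET.
exists (@Dfa A _ (dfa_start D, dfa_start E) final step).
have stepE w p q :
    foldl step (p, q) w = (foldl (@dfa_step _ D) p w, foldl (@dfa_step _ E) q w).
  by elim: w p q => //= a w IHw p q; rewrite IHw.
by apply/seteqP; split=> w; rewrite /dfa_lang /= stepE inE => /orP.
Qed.

Section MarkFirst.
Variable A : finType.

(** The flag [true] singles out the letter into which the point of the class will be fused. *)
Definition mark_first (w : seq A) : seq (bool * A) :=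
  if w is a :: w' then (true, a) :: map (pair false) w' else [::].

Lemma mark_first_cat u v w : u != [::] -> mark_first w = u ++ v ->
  exists u' v', [/\ mark_first u' = u, w = u' ++ v' & map snd v = v'].
Proof.
have unpairK : cancel (map (pair false)) (map (@snd bool A)) by exact: mapK.
case: w u => [|a w] [|c u] //= _ [<- E].
exists (a :: map snd u), (map snd v); split=> //=; last by rewrite -map_cat -E unpairK.
have -> : u = map (pair false) (take (size u) w) by rewrite map_take E take_size_cat.
by rewrite unpairK.
Qed.

Lemma regular_mark_first (L : set (seq A)) :
  regular L -> regular [set mark_first w | w in L].
Proof.
(* The state records whether a letter has been read; the flag must be [true] on the first letter and
   [false] afterwards. *)
pose e (started : bool) (c : bool * A) :=
  if c.1 == ~~ started then Some (true, c.2) else None.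
have eT w v : transduce e true w = Some v <-> map (pair false) v = w.
  elim: w v => [|[[] a] w IHw] [|b v] //=; first by case: transduce.
  split=> [|[-> /IHw->//]].
  by case E: transduce => [u|] //= -[<- <-]; congr (_ :: _); apply/IHw.
have eF w v : transduce e false w = Some v <-> mark_first v = w.
  case: w v => [|[[] a] w] [|b v] //=; first by case: transduce.
  split=> [|[-> /eT->//]].
  by case E: transduce => [u|] //= -[<- <-]; congr (_ :: _); apply/eT.
move=> /(regular_transduce e false) regL; congr regular: regL.
by apply/seteqP; split=> [w [v /eF ? ?]|w [v ? /eF ?]]; exists v.
Qed.

End MarkFirst.

(** * Values of words under homomorphisms *)

Section Represents.
Variables (A : finType) (S : semigroupType) (phi : A -> S).

Lemma represents_inj w s t : represents phi w s -> represents phi w t -> s = t.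
Proof. by case: w => //= a w <- <-. Qed.

(** Covers both a change of alphabet ([m] the identity) and the inclusion of a subsemigroup ([f] the
    identity). *)
Lemma represents_morph (B : finType) (S' : semigroupType) (psi : B -> S')
    (f : A -> B) (m : S -> S') w s :
    {morph m : x y / x * y} -> (forall a, psi (f a) = m (phi a)) ->
  represents phi w s -> represents psi (map f w) (m s).
Proof.
move=> mM mE; case: w => //= a w <-.
by elim: w a => [|b w IHw] a //=; rewrite ?mM -?IHw ?mE.
Qed.

End Represents.

(** * Markov languages for subsets of a semigroup, and their disjoint unions *)

Section MarkovOn.
Variable S : semigroupType.

(** [X] need not be closed under products and letters may have values outside it, so [on_sub] has to
    require that words of [L] stay in [X]. *)
Record markov_language_on (X : set S) (A : finType) (phi : A -> S)
    (L : set (seq A)) : Prop := MarkovLanguageOn {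
  on_regular : regular L;
  on_nonempty_words : ~ L [::];
  on_prefix_closed : plus_prefix_closed L;
  on_sub : forall w, L w -> exists2 s, X s & represents phi w s;
  on_unique : forall s, X s -> exists! w, L w /\ represents phi w s }.

Definition markov_on (X : set S) : Prop :=
  exists (A : finType) (phi : A -> S) (L : set (seq A)), markov_language_on X phi L.

Lemma markov_on_setT : markov_on setT -> markov S.
Proof.
move=> [A [phi [L [regL L0 pfxL _ uniqL]]]].
exists A, phi; split; last by exists L; split=> // s; exact: uniqL.
by move=> s; have [w [[_ ws] _]] := uniqL s I; exists w.
Qed.

Lemma plus_prefix_closed_map (A B : finType) (f : A -> B) (L : set (seq A)) :
  plus_prefix_closed L -> plus_prefix_closed [set map f w | w in L].
Proof.
move=> pfxL u v u0 v0 [w Lw E].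
have uE : map f (take (size u) w) = u by rewrite map_take E take_size_cat.
have vE : map f (drop (size u) w) = v by rewrite map_drop E drop_size_cat.
exists (take (size u) w) => //; apply: (pfxL _ (drop (size u) w)).
- by apply: contraNneq u0 => w0; rewrite -uE w0.
- by apply: contraNneq v0 => w0; rewrite -vE w0.
- by rewrite cat_take_drop.
Qed.

(** The alphabets are made disjoint, so each word comes from one side only; as [X] and [Y] are
    disjoint, no element gets a word from both. *)
Lemma markov_onU (X Y : set S) :
  X `&` Y `<=` set0 -> markov_on X -> markov_on Y -> markov_on (X `|` Y).
Proof.
move=> XY0 [A [phi [L [regL L0 pfxL subL uniqL]]]].
move=> [B [psi [M [regM M0 pfxM subM uniqM]]]].
pose chi (c : A + B) := match c with inl a => phi a | inr b => psi b end.
have chil w s : represents phi w s -> represents chi (map inl w) s.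
  exact: (represents_morph (m := id)).
have chir w s : represents psi w s -> represents chi (map inr w) s.
  exact: (represents_morph (m := id)).
exists (A + B)%type, chi, ([set map inl w | w in L] `|` [set map inr w | w in M]).
split.
- by apply: regularU; apply: regular_map => // ? ? [].
- by case=> -[[|]].
- move=> u v u0 v0 [Luv|Muv]; [left|right].
    exact: (plus_prefix_closed_map pfxL) Luv.
  exact: (plus_prefix_closed_map pfxM) Muv.
- move=> _ [[w /subL[s Xs ws] <-]|[w /subM[s Ys ws] <-]]; exists s; auto;
  by [left|right].
- move=> s [Xs|Ys].
    have [w [[Lw ws] w_uniq]] := uniqL s Xs.
    exists (map inl w); split=> [|_ [[[v Lv <-]|[v Mv <-]] vs]].
    + by split; [left; exists w|exact: chil].
    + congr map; apply: w_uniq; split=> //; have [t _ vt] := subL _ Lv.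
      by rewrite (represents_inj vs (chil _ _ vt)).
    + have [t Yt vt] := subM _ Mv.
      by have [] := XY0 s; split=> //; rewrite (represents_inj vs (chir _ _ vt)).
  have [w [[Mw ws] w_uniq]] := uniqM s Ys.
  exists (map inr w); split=> [|_ [[[v Lv <-]|[v Mv <-]] vs]].
  + by split; [right; exists w|exact: chir].
  + have [t Xt vt] := subL _ Lv.
    by have [] := XY0 s; split=> //; rewrite (represents_inj vs (chil _ _ vt)).
  + congr map; apply: w_uniq; split=> //; have [t _ vt] := subM _ Mv.
    by rewrite (represents_inj vs (chir _ _ vt)).
Qed.

Lemma set_consU (I : eqType) (x : I) (s : seq I) : [set` x :: s] = x |` [set` s].
Proof. by apply/seteqP; split=> y /=; rewrite in_cons => /predU1P. Qed.

Lemma markov_onU_seq (X : set S) (Ys : seq (set S)) :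
    uniq (X :: Ys) -> {in X :: Ys &, forall Y Z, Y `&` Z !=set0 -> Y = Z} ->
    {in X :: Ys, forall Y, markov_on Y} ->
  markov_on (\bigcup_(Y in [set` X :: Ys]) Y).
Proof.
elim: Ys X => [|Z Ys IH] X.
  by move=> _ _ /(_ X (mem_head _ _)); rewrite set_cons1 bigcup_set1.
move=> /andP[XZ uniqZ] disj mark; rewrite set_consU bigcup_setU1.
apply: markov_onU; last 2 first.
- by apply: mark; exact: mem_head.
- apply: IH => // [Y Y' YZ YZ'|Y YZ]; last by apply: mark; rewrite in_cons YZ orbT.
  by apply: disj; rewrite in_cons ?YZ ?YZ' orbT.
- move=> s [Xs [Y /= YZ Ys_]]; move/negP: XZ; apply.
  rewrite (disj X Y) ?mem_head //; first by rewrite in_cons YZ orbT.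
  by exists s.
Qed.

End MarkovOn.

(** * Relative Green's relations *)

Section RelativeGreen.
Variables (S : semigroupType) (T : mulgClosed S).

Lemma markov_on_sub_semigroup :
  markov (sub_semigroup T) -> markov_on [set x | x \in T].
Proof.
move=> [A [phi [_ [L [regL L0 pfxL uniqL]]]]].
pose psi a := val (phi a).
have psiP w t : represents phi w t -> represents psi w (val t).
  move=> /(represents_morph (psi := psi) (f := id) (m := val)).
  by rewrite map_id; apply=> //; exact: valM.
exists A, psi, L; split=> // [[//|a w] Lw|s Ts].
  by exists (val (word_value phi a w)); [exact: valP|exact: psiP].
pose t : sub_semigroup T := Sub s Ts.
have [w [[Lw wt] w_uniq]] := uniqL t; exists w; split=> [|[|a v] [Lv vs]] //.
  by split=> //; rewrite -[s]/(val t); exact: psiP.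
apply: w_uniq; split=> //; apply: val_inj.
exact: represents_inj (psiP (a :: v) _ erefl) vs.
Qed.

Lemma relH_mem (x y : S) : relH T x y -> x \in T -> y \in T.
Proof.
move=> [R _] Tx; have : range (ract (T := T) y) y by exists (None : adjoin1 (sub_semigroup T)).
by rewrite -R => -[[t|] _ <-] //=; apply: gpredM => //; exact: valP.
Qed.

Lemma relH_sym (x y : S) : relH T x y -> relH T y x.
Proof. by case. Qed.

Lemma relH_trans (y x z : S) : relH T x y -> relH T y z -> relH T x z.
Proof. by move=> [xyR xyL] [yzR yzL]; split; [rewrite /relR xyR|rewrite /relL xyL]. Qed.

Lemma relR_ract (x y : S) : relR T x y -> exists t, ract (T := T) x t = y.
Proof.
move=> R; have : range (ract (T := T) y) y by exists (None : adjoin1 (sub_semigroup T)).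
by rewrite -R => -[t _ ?]; exists t.
Qed.

Lemma relL_lact (x y : S) : relL T x y -> exists t, lact (T := T) t x = y.
Proof.
move=> L; have : range ((@lact S T)^~ y) y by exists (None : adjoin1 (sub_semigroup T)).
by rewrite -L => -[t _ ?]; exists t.
Qed.

(** Multiplying by [u] undoes [t], so each of the two right ideals contains the other. *)
Lemma relR_ractP (x : S) t u : ract (T := T) (ract x t) u = x -> relR T x (ract (T := T) x t).
Proof.
move=> xtu; apply/seteqP; split=> _ [v _ <-]; last by exists (t * v); rewrite ?ractM.
by exists (u * v); rewrite // ractM xtu.
Qed.

Lemma relL_ract (x y : S) t : relL T x y -> relL T (ract (T := T) x t) (ract (T := T) y t).
Proof.
move=> L; apply/seteqP; split=> _ [v _ <-]; rewrite -lact_ract.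
  have : range ((@lact S T)^~ x) (lact v x) by exists v.
  by rewrite L => -[w _ /= <-]; exists w => //; rewrite lact_ract.
have : range ((@lact S T)^~ y) (lact v y) by exists v.
by rewrite -L => -[w _ /= <-]; exists w => //; rewrite lact_ract.
Qed.

(** * A single class and its Schützenberger group *)

Section Hclass.
Variables (H : set S) (h0 : S).
Hypothesis HE : H = [set y | relH T h0 y].

Let Hh0 : H h0. Proof. by rewrite HE. Qed.

Let relHH x y : H x -> H y -> relH T x y.
Proof. by rewrite HE => /relH_sym; exact: relH_trans. Qed.

(* Green's lemma, relative to [T]. *)
Lemma Hclass_ract x t : H x -> H (ract (T := T) x t) ->
  forall h, H h -> H (ract (T := T) h t).
Proof.
move=> Hx Hxt h Hh; rewrite HE; apply: (relH_trans (relHH Hh0 Hh)); split.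
  have [u xtu] := relR_ract (relHH Hxt Hx).1.
  (* Writing [h] as [s x] carries the identity [x t u = x] over to [h]. *)
  have [s <-] := relL_lact (relHH Hx Hh).2.
  by apply: (@relR_ractP _ _ u); rewrite !lact_ract xtu.
by rewrite /relL (relHH Hh Hxt).2; apply: relL_ract; exact: (relHH Hx Hh).2.
Qed.

(** An element [u] returning [x t] to [x] also maps [H] into itself, and [h u] is the preimage of
    [h] under [t]. *)
Lemma Hclass_stab x t : H x -> H (ract (T := T) x t) -> in_stab H t.
Proof.
move=> Hx Hxt; apply/in_stabP; split=> [|h Hh]; first exact: Hclass_ract Hxt.
have [u xtu] := relR_ract (relHH Hxt Hx).1.
exists (ract h u); first by apply: (Hclass_ract Hxt) => //; rewrite xtu.
have [s <-] := relL_lact (relHH Hxt Hh).2.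
by rewrite !lact_ract xtu.
Qed.

Local Notation class x := (\pi_(schutzenberger T H) x).

(** The map [g |-> h0 g], computed on a chosen representative; [schutzenberger_act_pi] shows that
    the choice is immaterial. *)
Definition schutzenberger_act (g : schutzenberger T H) : S :=
  ract (T := T) h0 (val (repr g)).

Lemma schutzenberger_act_pi (x : stab T H) :
  schutzenberger_act (class x) = ract (T := T) h0 (val x).
Proof.
have : sigma (repr (class x)) x by apply/eqmodP; rewrite reprK.
by move=> /asboolP; apply.
Qed.

Lemma schutzenberger_actM g (x : stab T H) :
  schutzenberger_act (g * class x) = ract (T := T) (schutzenberger_act g) (val x).
Proof.
elim/quotW: g => y.
have -> : class y * class x = class (y * x) by rewrite [RHS]pi_schutzenberger_mul.
by rewrite !schutzenberger_act_pi valM ractM.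
Qed.

Lemma schutzenberger_act_mem g : H (schutzenberger_act g).
Proof. by apply: stab_image => //; exact: valP. Qed.

(** Every [h] in [H] is some [s h0], so stabilizer elements that agree at [h0] agree on all of
    [H]. *)
Lemma schutzenberger_act_inj : injective schutzenberger_act.
Proof.
elim/quotW=> x; elim/quotW=> y; rewrite !schutzenberger_act_pi => xy.
apply/eqmodP/asboolP => h Hh.
by have [s <-] := relL_lact (relHH Hh0 Hh).2; rewrite !lact_ract xy.
Qed.

Lemma schutzenberger_act_surj y : H y -> exists g, schutzenberger_act g = y.
Proof.
move=> Hy; have [t ty] := relR_ract (relHH Hh0 Hy).1.
have tP : in_stab H t by apply: (Hclass_stab Hh0); rewrite ty.
by exists (class (Sub t tP : stab T H)); rewrite schutzenberger_act_pi SubK.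
Qed.

(** Letters take values in [S], so a class containing only the adjoined identity gives no value for
    an unmarked letter. *)
Definition T_representable (g : schutzenberger T H) : Prop :=
  exists (x : stab T H) t, val x = Some t /\ class x = g.

(* If some [t] in [T] stabilizes [H] and [z] is inverse to it, then any [y] in
   the stabilizer acts on [H] as [y z t], which is in [T] even if [y = 1]. *)
Lemma T_representable_or_trivial :
  (forall g, T_representable g) \/ forall g g' : schutzenberger T H, g = g'.
Proof.
have [[x [t xt]]|no_t] := pselect (exists (x : stab T H) t, val x = Some t).
  left; elim/quotW=> y.
  have [z [zx _]] := schutzenberger_inv (ex_intro _ h0 HE) (class x).
  elim/quotW: z zx => z zx; exists (y * (z * x)).
  have [u uE] : exists u, val (y * (z * x)) = Some u.
    rewrite !valM xt; case: (val y) (val z) => [y'|] [z'|].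
    - by exists (y' * (z' * t)).
    - by exists (y' * t).
    - by exists (z' * t).
    - by exists t.
  exists u; split=> //.
  rewrite [LHS]pi_schutzenberger_mul [in LHS]pi_schutzenberger_mul.
  by rewrite -[RHS]mulg1 -zx.
(* Here the stabilizer consists of the adjoined identity alone. *)
right; elim/quotW=> x; elim/quotW=> y; congr (class _); apply: val_inj.
case xE: (val x) => [t|]; first by case: no_t; exists x, t.
by case yE: (val y) => [t|]; first by case: no_t; exists y, t.
Qed.

Lemma markov_on_Hclass : markov (schutzenberger T H) -> markov_on H.
Proof.
move=> [B [psi [_ [M [regM M0 pfxM uniqM]]]]].
have /choice[rho rhoP] : forall b, exists s, T_representable (psi b) ->
    exists (x : stab T H) t, [/\ val x = Some t, class x = psi b & val t = s].
  move=> b; have [[x [t [xt xb]]]|?] := pselect (T_representable (psi b)).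
    by exists (val t) => _; exists x, t.
  (* A default value: by [phiP] below, such a letter never follows the first letter of a word of
     [M]. *)
  by exists h0.
pose phi (c : bool * B) := if c.1 then schutzenberger_act (psi c.2) else rho c.2.
have phiP w g : M w -> represents psi w g ->
    represents phi (mark_first w) (schutzenberger_act g).
  case: w => //= a w Maw.
  have {Maw} : {in w, forall b, T_representable (psi b)}.
    (* Over a trivial group [M] has a single word; a longer word would share its value with its own
       first letter, also in [M]. *)
    case: T_representable_or_trivial => [repT b _|triv]; first exact: repT.
    case: w Maw => // b w Mabw.
    have Ma : M [:: a] by exact: (@pfxM [:: a] (b :: w)).
    have [v [_ v_uniq]] := uniqM 1.
    have va := v_uniq [:: a] (conj Ma (triv _ _)).
    by have := v_uniq [:: a, b & w] (conj Mabw (triv _ _)); rewrite va.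
  (* Induction from the right end, because the action turns right multiplication in the group into
     right multiplication by [rho b]. *)
  move=> + <-; elim/last_ind: w => //= w b IHw repT.
  have -> : word_value psi a (rcons w b) = word_value psi a w * psi b.
    by have := @represents_cat _ _ psi (a :: w) [:: b] _ _ erefl erefl; rewrite cats1.
  have [|x [t [xt <- tb]]] := rhoP b; first by apply: repT; rewrite mem_rcons mem_head.
  rewrite schutzenberger_actM xt /= tb map_rcons -cats1.
  apply: (@represents_cat _ _ phi (_ :: _) [:: _] _ _ _ erefl).
  by apply: IHw => c cw; apply: repT; rewrite mem_rcons in_cons cw orbT.
exists (bool * B)%type, phi, [set mark_first w | w in M]; split.
- exact: regular_mark_first.
- by case=> -[].
- move=> u v u0 v0 [w Mw /(mark_first_cat u0)[u' [v' [uE wE vE]]]].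
  exists u' => //; apply: (pfxM _ v'); rewrite -?wE //.
    by apply: contraNneq u0 => u'0; rewrite -uE u'0.
  by rewrite -vE; case: (v) v0.
- move=> _ [[//|a w] Mw <-]; exists (schutzenberger_act (word_value psi a w)).
    exact: schutzenberger_act_mem.
  exact: phiP.
- move=> s /schutzenberger_act_surj[g <-].
  have [w [[Mw wg] w_uniq]] := uniqM g.
  exists (mark_first w); split=> [|_ [[[//|a v] Mv <-] vg]].
    by split; [exists w|exact: phiP].
  congr mark_first; apply: w_uniq; split=> //; apply: schutzenberger_act_inj.
  exact: represents_inj (phiP (a :: v) _ Mv erefl) vg.
Qed.

End Hclass.

(** * Decomposition of [S] into [T] and the outer classes, and the conclusion *)

Lemma outer_Hclasses_cover :
  \bigcup_(H in [set x | x \in T] |` outer_Hclasses T) H = setT.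
Proof.
apply/seteqP; split=> // x _; have [Tx|nTx] := boolP (x \in T).
  by exists [set x | x \in T] => //; left.
exists [set y | relH T x y]; last by [].
right; split; first by exists x.
by move=> y xy; apply: contra nTx => Ty; apply: relH_mem Ty; exact: relH_sym.
Qed.

Lemma outer_Hclasses_disjoint (H K : set S) :
  outer_Hclasses T H -> outer_Hclasses T K -> H `&` K !=set0 -> H = K.
Proof.
move=> [[x ->] _] [[y ->] _] [z [/= xz yz]].
have xy := relH_trans xz (relH_sym yz).
apply/seteqP; split=> w; [apply: relH_trans; exact: relH_sym|exact: relH_trans].
Qed.

End RelativeGreen.

Theorem proposition16p6 (S : semigroupType) (T : mulgClosed S)
    (green_fin : finite_green_index T)
    (markov_T : markov (sub_semigroup T))
    (markov_schutzenberger :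
      forall H : set S, outer_Hclasses T H -> markov (schutzenberger T H)) :
  markov S.
Proof.
have [Hs HsE] := (finite_seqP _).1 green_fin.
(* Repetitions are removed because the finite union needs pairwise distinct pieces. *)
have HsP H : H \in undup Hs <-> outer_Hclasses T H by rewrite mem_undup HsE.
pose TT := [set x | x \in T].
have T_disj H : outer_Hclasses T H -> TT `&` H !=set0 -> False.
  by move=> [_ HT] [x [/= Tx /HT /=]]; rewrite Tx.
have outer_mem H : outer_Hclasses T H -> H !=set0.
  by move=> [[x ->] _]; exists x.
apply: markov_on_setT; rewrite -(outer_Hclasses_cover T) HsE.
have -> : TT |` [set` Hs] = [set` TT :: undup Hs].
  by rewrite set_consU; congr setU; apply/seteqP; split=> K /=; rewrite mem_undup.
apply: markov_onU_seq.
(* [T] is not an outer class: it would be nonempty and disjoint from itself. *)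
- rewrite /= undup_uniq andbT; apply/negP => /HsP oT.
  by apply: (T_disj _ oT); rewrite setIid; exact: outer_mem.
- move=> H K; rewrite !in_cons => /predU1P[->|/HsP oH] /predU1P[->|/HsP oK] //.
  + by move=> /(T_disj _ oK).
  + by rewrite setIC => /(T_disj _ oH).
  + exact: outer_Hclasses_disjoint oH oK.
- move=> H; rewrite in_cons => /predU1P[->|/HsP oH]; first exact: markov_on_sub_semigroup.
  have [[x HE] _] := oH.
  by apply: (markov_on_Hclass HE); exact: markov_schutzenberger.
Qed.
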